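(* For each $\nu>-1$ the radius of convexity $r^c(g_\nu)$ satisfies $r^c(g_\nu)<\sqrt[4]{\frac{4(\nu+1)_3}{5}}$. Moreover, if $\nu>-1$, then $$2\sqrt[4]{\frac{(\nu+1)_3}{25}}<r^c(g_\nu)<2\sqrt[4]{\frac{25(\nu+1)_5}{\nu_{13}}}$$ and $$2\sqrt[8]{\frac{(\nu+1)_3(\nu+1)_5}{\nu_{13}}}<r^c(g_\nu)<\sqrt[4]{\frac{8(\nu+1)_3(\nu+6)(\nu+7)\nu_{13}}{3\nu_{14}}},$$ where $$\nu_{13}=544\nu^2+5301\nu+12257,\qquad \nu_{14}=2112\nu^4+48784\nu^3+417279\nu^2+1556904\nu+2123797.$$
   Context: For $\nu>-1$, with $J_\nu,I_\nu$ the Bessel and modified Bessel functions of the first kind, $$\mathbf{\Phi}_\nu(z)=J_\nu(z)I_\nu'(z)-J_\nu'(z)I_\nu(z)=2\sum_{n\ge0}\frac{(-1)^n(z/2)^{2\nu+4n+1}}{n!\,\Gamma(\nu+n+1)\Gamma(\nu+2n+2)},$$ $$g_\nu(z)=2^{2\nu}z^{-2\nu}\Gamma(\nu+1)\Gamma(\nu+2)\mathbf{\Phi}_\nu(z)=\sum_{n\ge0}\frac{(-1)^n z^{4n+1}}{2^{4n}n!\,(\nu+1)_n(\nu+2)_{2n}}.$$ The radius of convexity is $r^c(f)=\sup\{r>0:\operatorname{Re}(1+zf''(z)/f'(z))>0\text{ for all }|z|<r\}$. Pochhammer symbol: $(a)_0=1$, $(a)_n=a(a+1)\cdots(a+n-1)$.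 *)

(* Defs.v *)
From HB Require Import structures.
From mathcomp Require Import all_boot all_order all_algebra.
From mathcomp Require Import complex.
From mathcomp Require Import all_classical all_reals all_analysis.

Set Implicit Arguments.
Unset Strict Implicit.
Unset Printing Implicit Defensive.

Import Order.TTheory GRing.Theory Num.Theory.
Import numFieldNormedType.Exports.

Local Open Scope ring_scope.
Local Open Scope complex_scope.
Local Open Scope classical_set_scope.

(* R : realType is the field of real numbers (MathComp-Analysis), and R[i]^o the
   complex numbers as a normed space over themselves, so that derive1 is the
   complex derivative. *)

Definition pochhammer (K : pzRingType) (a : K) (n : nat) : K :=
  \prod_(i < n) (a + i%:R).

(* The normalized cross-product of Bessel functions
     g_nu(z) = 2^(2nu) z^(-2nu) Gamma(nu+1) Gamma(nu+2)
                 (J_nu(z) I_nu'(z) - J_nu'(z) I_nu(z))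
             = \sum_(n >= 0) (-1)^n z^(4n+1)
                             / (2^(4n) n! (nu+1)_n (nu+2)_(2n)).
   The series is used as the definition: it is single-valued on the whole
   plane, whereas the first expression needs a branch of z^nu and a value at
   z = 0. *)
Definition bessel_cross_coef (R : realType) (nu : R) (n : nat) : R :=
  (-1) ^+ n /
  (2 ^+ (4 * n) * n`!%:R * pochhammer (nu + 1) n * pochhammer (nu + 2) (2 * n)).

Definition bessel_cross (R : realType) (nu : R) (z : R[i]^o) : R[i]^o :=
  limn [series (bessel_cross_coef nu n)%:C * z ^+ (4 * n + 1) : R[i]^o]_n.

(* The supremum is taken in the extended reals, as it may be infinite.  The
   condition f'(z) <> 0 makes explicit that the quotient must be defined at
   every point of the disk (division by zero would otherwise give 0). *)
Definition radius_of_convexity (R : realType) (f : R[i]^o -> R[i]^o) : \bar R :=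
  ereal_sup [set r%:E | r in [set r : R | 0 < r /\
    forall z : R[i]^o, `|z| < r%:C ->
      derive1 f z != 0 /\ 0 < complex.Re (1 + z * derive1n 2 f z / derive1 f z)]].

(* Numerals in ring_scope are unary, so integers above 5000 are written in
   base 1000. *)
Definition nu13 (R : realType) (nu : R) : R :=
  544 * nu ^+ 2 + (5 * 1000 + 301) * nu + (12 * 1000 + 257).

Definition nu14 (R : realType) (nu : R) : R :=
  2112 * nu ^+ 4 + (48 * 1000 + 784) * nu ^+ 3 + (417 * 1000 + 279) * nu ^+ 2
  + (1556 * 1000 + 904) * nu + (2123 * 1000 + 797).

(* Main.v *)
Require Import Defs.
From HB Require Import structures.
From mathcomp Require Import all_boot all_order all_algebra.
From mathcomp Require Import complex.
From mathcomp Require Import all_classical all_reals all_analysis.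
From mathcomp Require Import ring lra.
Import Order.TTheory GRing.Theory Num.Theory.
Import numFieldNormedType.Exports.
Local Open Scope ring_scope.

Set Implicit Arguments.
Unset Strict Implicit.
Unset Printing Implicit Defensive.

(** Put [x = nu + 1], [P = x (x + 1) (x + 2)] and [t = z^4 / (16 P)]. Then
    [g'(z) = G(t)] and [g'(z) + z g''(z) = D(t)], where
      [G(t) = \sum_n (-1)^n (4 n + 1) c_n t^n],
      [D(t) = \sum_n (-1)^n (4 n + 1)^2 c_n t^n],
    and [c_n > 0] satisfies [c_0 = c_1 = 1] and [(n + 1) c_(n+1) <= c_n]. Hence
    [1 + z g'' / g' = D(t) / G(t)], and everything is about the quotient [D / G].

    Upper bounds. At a small real [T > 0] the series [D(T)] alternates with decreasing
    terms from index 1 on, so it is at most its partial sum of degree 4. If that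
    sum is not positive, the convexity condition fails at the real point [z] with
    [z^4 = 16 P T], and [16 P T] bounds the fourth power of the radius
    ([radius_of_convexity_le]). The partial sum is negative at the value [X] of
    [T] that corresponds to the sharpest upper bound ([dsum4_lt0]), hence also
    slightly to the left of [X], which gives strict inequalities. The two other
    upper bounds are larger than this one.

    Lower bounds. Write [D = G (1 - 4 Q)] with [Q = - t G' / G]. The point is that
    all power series coefficients [p_n] of [Q] are nonnegative. (This would follow
    from the reality of the zeros of [G], for which [p_n] is the sum of their
    inverse [n]-th powers; here it is read off the recurrence defining [p_n],
    because the [c_n] decay so fast that the alternating sum in the recurrence is
    dominated by its first two terms: [quotient_coef_bounds].) Therefore
    [|Q(t)| <= Q(T)] for [|t| <= T], and [Q(T) < 1 / 4] as soon as [D(T) > 0], so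
    that the real part of [D / G] is positive on the whole disk ([convex_disk]).
    Positivity of [D(T)] is read off its partial sum of degree 3, which is positive
    at the value [Y] of [T] that corresponds to the sharper lower bound
    ([dsum3_gt0]), and slightly beyond it.

    What remains is analysis: [g] is differentiated term by term
    ([derive1_monomial_series]), the identity [G - D = 4 G Q] is a Cauchy product
    ([cauchy_product]), and the comparisons between the bounds are polynomial
    inequalities in [x] whose nonzero coefficients all have the same sign. *)

(** * Real-valued modulus, complex sequences and series *)

(** The norm of [R[i]] takes its values in [R[i]] itself; estimates and order
    arguments are easier with a modulus that lives in [R]. *)
Definition cabs (R : realType) (z : R[i]) : R := Normc.normc z.

Lemma norm_cabs (R : realType) (z : R[i]) : `|z| = (cabs z)%:C%C.
Proof. by []. Qed.

Lemma cabs_ge0 (R : realType) (z : R[i]) : 0 <= cabs z.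
Proof. by rewrite -lecR -norm_cabs normr_ge0. Qed.

Lemma cabsD (R : realType) (z w : R[i]) : cabs (z + w) <= cabs z + cabs w.
Proof. exact: le_normcD. Qed.

Lemma cabsM (R : realType) (z w : R[i]) : cabs (z * w) = cabs z * cabs w.
Proof. exact: Normc.normcM. Qed.

Lemma cabs0 (R : realType) : cabs (0 : R[i]) = 0.
Proof. exact: Normc.normc0. Qed.

Lemma cabsN (R : realType) (z : R[i]) : cabs (- z) = cabs z.
Proof. exact: normcN. Qed.

Lemma cabs_real (R : realType) (x : R) : cabs x%:C%C = `|x|.
Proof. by rewrite /cabs /Normc.normc /= expr0n addr0 sqrtr_sqr. Qed.

Lemma cabsX (R : realType) (z : R[i]) n : cabs (z ^+ n) = cabs z ^+ n.
Proof.
elim: n => [|n IH]; first by rewrite !expr0 /cabs Normc.normc1.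
by rewrite !exprS cabsM IH.
Qed.

Lemma cabs_distC (R : realType) (z w : R[i]) : cabs (z - w) = cabs (w - z).
Proof. by rewrite -(cabsN (z - w)) opprB. Qed.

Lemma cabs_Re (R : realType) (z : R[i]) : `|complex.Re z| <= cabs z.
Proof. by rewrite -lecR -norm_cabs normc_ge_Re. Qed.

Lemma cabs_sum (R : realType) (I : Type) (r : seq I) (P : pred I) (F : I -> R[i]) :
  cabs (\sum_(i <- r | P i) F i) <= \sum_(i <- r | P i) cabs (F i).
Proof.
elim/big_rec2: _ => [|i y x _ xy]; first by rewrite cabs0.
by apply: le_trans (cabsD _ _) _; rewrite lerD2l.
Qed.

(** Reduces convergence in [R[i]^o] to convergence of a real sequence, because
    every positive element of [R[i]] is real. *)
Lemma ccvgP (R : realType) (u : nat -> R[i]^o) (l : R[i]^o) :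
  (u n @[n --> \oo] --> l)%classic <->
  ((cabs (u n - l) : R) @[n --> \oo] --> (0 : R))%classic.
Proof.
split=> [/cvgrPdist_lt ul|/cvgrPdist_lt ul]; apply/cvgrPdist_lt => e e0.
- have e0' : 0 < e%:C%C by rewrite ltcR.
  near=> n; rewrite sub0r normrN (ger0_norm (cabs_ge0 _)) cabs_distC -ltcR.
  by rewrite -norm_cabs; near: n; exact: ul.
- have [er ei] : 0 < complex.Re e /\ e = (complex.Re e)%:C%C.
    by case: e e0 => a b; rewrite ltcE /= => /andP[/eqP -> ?].
  near=> n; rewrite norm_cabs ei ltcR cabs_distC.
  rewrite -[X in X < _](ger0_norm (cabs_ge0 _)) -normrN -sub0r.
  by near: n; exact: ul.
Unshelve. all: by end_near. Qed.

Lemma ccvg_real (R : realType) (u : nat -> R) (l : R) :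
  (u n @[n --> \oo] --> l)%classic ->
  ((u n)%:C%C @[n --> \oo] --> (l%:C%C : R[i]^o))%classic.
Proof.
move=> ul; apply/ccvgP.
have -> : (fun n => cabs ((u n)%:C%C - l%:C%C)) = (fun n => `|u n - l|).
  by apply/funext => n; rewrite -rmorphB cabs_real.
rewrite -(@normr0 _ R); apply: cvg_norm.
by rewrite -(subrr l); apply: cvgB => //; exact: cvg_cst.
Qed.

Lemma cabs_sub_le (R : realType) (z w : R[i]) : `|cabs z - cabs w| <= cabs (z - w).
Proof.
have := cabsD (z - w) w; have := cabsD (w - z) z.
rewrite !subrK (cabs_distC w z) ler_norml => h1 h2.
by apply/andP; split; lra.
Qed.

Lemma ccvg_cabs (R : realType) (u : nat -> R[i]^o) (l : R[i]^o) :
  (u n @[n --> \oo] --> l)%classic ->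
  (cabs (u n) @[n --> \oo] --> cabs l)%classic.
Proof.
move=> /ccvgP /cvgrPdist_lt ul; apply/cvgrPdist_lt => e e0.
near=> n; rewrite distrC; apply: le_lt_trans (cabs_sub_le _ _) _.
rewrite -[X in X < _](ger0_norm (cabs_ge0 _)) -normrN -sub0r.
by near: n; exact: ul.
Unshelve. all: by end_near. Qed.

(** Replaces the completeness of the complex plane: the real and imaginary parts
    converge absolutely. *)
Lemma is_cvg_cseries (R : realType) (a : nat -> R[i]^o) (v : nat -> R) :
  (forall n, cabs (a n) <= v n) -> cvgn (series v) -> cvgn (series a).
Proof.
move=> av cv.
have part (w : nat -> R) : (forall n, `|w n| <= cabs (a n)) -> cvgn (series w).
  move=> wa; apply: (@normed_cvg _ R^o).
  apply: series_le_cvg cv => n //=; last exact: le_trans (wa n) (av n).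
  by apply: le_trans (av n); exact: cabs_ge0.
have cre := part _ (fun n => cabs_Re (a n)).
have cim : cvgn (series (fun n => complex.Im (a n))).
  apply: part => n; case: (a n) => x y /=.
  by rewrite /cabs /Normc.normc -sqrtr_sqr ler_sqrt ?addr_ge0 ?sqr_ge0// lerDr sqr_ge0.
apply/cvg_ex; exists ((limn (series (fun n => complex.Re (a n))))%:C%C
  + 'i%C * (limn (series (fun n => complex.Im (a n))))%:C%C).
have -> : series a = (fun n => (series (fun n => complex.Re (a n)) n)%:C%C
   + 'i%C * (series (fun n => complex.Im (a n)) n)%:C%C).
  apply/funext => n; rewrite /series /= !rmorph_sum /= mulr_sumr -big_split /=.
  by apply: eq_bigr => i _; exact: complexE.
apply: cvgD; first exact: ccvg_real.
by apply: cvgM; [exact: cvg_cst|exact: ccvg_real].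
Qed.

(** * Termwise differentiation of rapidly decaying series of monomials *)

Lemma ccvg_le (R : realType) (u : nat -> R[i]^o) (l : R[i]^o) (v : nat -> R) (m : R) :
  (forall n, cabs (u n) <= v n) ->
  (u n @[n --> \oo] --> l)%classic -> (v n @[n --> \oo] --> m)%classic ->
  cabs l <= m.
Proof.
move=> uv /ccvg_cabs ul vm.
by apply: (ler_cvg_to ul vm); apply: nearW => n; exact: uv.
Qed.

(** Series of monomials with arbitrary exponents [e n], so that a lacunary series
    such as the Bessel cross-product and all its derivatives have this shape
    without reindexing. *)
Definition monomial_series (R : realType) (b : nat -> R) (e : nat -> nat) (z : R[i]^o)
  : R[i]^o := limn (series (fun n => (b n)%:C%C * z ^+ e n : R[i]^o)).

(** Absolute convergence on every disk, with a geometric majorant. Quantifying over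
    all radii [rho] makes the class stable under termwise differentiation. *)
Definition fast_decay (R : realType) (b : nat -> R) (e : nat -> nat) : Prop :=
  forall rho, 1 <= rho -> exists C, forall n, `|b n| * rho ^+ e n <= geometric C (2^-1) n.

(** The factor [e n] is at most [2 ^+ e n], which is absorbed by doubling the
    radius. *)
Lemma fast_decay_deriv (R : realType) (b : nat -> R) (e : nat -> nat) :
  fast_decay b e -> fast_decay (fun n => b n * (e n)%:R) (fun n => (e n).-1).
Proof.
move=> be rho rho1.
have [C HC] : exists C, forall n, `|b n| * (2 * rho) ^+ e n <= geometric C (2^-1) n.
  by apply: be; lra.
exists C => n; apply: le_trans (HC n); rewrite normrM -mulrA ler_wpM2l// exprMn.
rewrite ger0_norm ?ler0n// ler_pM ?ler0n// ?exprn_ge0//; first lra.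
- by rewrite -natrX ler_nat ltnW// ltn_expl.
- by rewrite ler_weXn2l// leq_pred.
Qed.

Lemma geometric_half_cvg (R : realType) (C : R) :
  (series (geometric C (2^-1)) n @[n --> \oo] --> 2 * C)%classic.
Proof.
have -> : 2 * C = C / (1 - 2^-1) by field.
by apply: cvg_geometric_series; rewrite ger0_norm; lra.
Qed.

Lemma fast_decay_cvg (R : realType) (b : nat -> R) (e : nat -> nat) (z : R[i]^o) :
  fast_decay b e -> cvgn (series (fun n => (b n)%:C%C * z ^+ e n : R[i]^o)).
Proof.
move=> be; have [|C HC] := be (1 + cabs z); first by rewrite lerDl cabs_ge0.
apply: (@is_cvg_cseries _ _ (geometric C (2^-1))).
  move=> n; apply: le_trans (HC n); rewrite cabsM cabsX cabs_real ler_wpM2l//.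
  by rewrite lerXn2r// ?nnegrE ?addr_ge0 ?cabs_ge0// lerDr.
by apply: cvgP; exact: geometric_half_cvg.
Qed.

(** Second-order remainder of a monomial, by induction on the degree: the
    remainder [E_m] satisfies [E_(m+1) = (h + z) E_m + m h^2 z^(m-1)]. *)
Lemma monomial_taylor (R : realType) (rho : R) (z h : R[i]) m :
  1 <= rho -> cabs z <= rho -> cabs (h + z) <= rho ->
  cabs ((h + z) ^+ m - z ^+ m - h * (m%:R * z ^+ m.-1)) <= cabs h ^+ 2 * (2 * rho) ^+ m.
Proof.
move=> r1 zr hr; elim: m => [|m IH].
  by rewrite !expr0 mul0r mulr0 !subrr cabs0 mulr1 sqr_ge0.
have -> : (h + z) ^+ m.+1 - z ^+ m.+1 - h * (m.+1%:R * z ^+ m.+1.-1) =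
   (h + z) * ((h + z) ^+ m - z ^+ m - h * (m%:R * z ^+ m.-1)) + h ^+ 2 * (m%:R * z ^+ m.-1).
  case: m {IH} => [|m]; first by rewrite /= !expr0 !expr1 mul0r; ring.
  by rewrite /= !exprS -natr1; ring.
apply: le_trans (cabsD _ _) _; rewrite !cabsM cabsX.
have mr : (m%:R : R[i]) = (m%:R : R)%:C%C by rewrite rmorph_nat.
have -> : cabs h ^+ 2 * (2 * rho) ^+ m.+1 = rho * (cabs h ^+ 2 * (2 * rho) ^+ m)
    + cabs h ^+ 2 * (rho * (2 * rho) ^+ m) by rewrite (exprS (2 * rho)); ring.
apply: lerD; first by rewrite ler_pM ?cabs_ge0.
rewrite -expr2 ler_wpM2l ?sqr_ge0// mr cabs_real ger0_norm ?ler0n// exprMn.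
have h1 : (m%:R : R) <= 2 ^+ m by rewrite -natrX ler_nat ltnW// ltn_expl.
have h2 : cabs z ^+ m.-1 <= rho ^+ m.
  apply: (@le_trans _ _ (rho ^+ m.-1)); last by rewrite ler_weXn2l// leq_pred.
  by rewrite lerXn2r// ?nnegrE ?cabs_ge0//; lra.
apply: (@le_trans _ _ (2 ^+ m * rho ^+ m)).
  by rewrite ler_pM ?ler0n ?exprn_ge0 ?cabs_ge0.
by rewrite ler_peMl// mulr_ge0// exprn_ge0//; lra.
Qed.

(** The bounds of [monomial_taylor] with radius [rho] sum up to a finite constant
    because the coefficients decay fast at radius [2 * rho]. *)
Lemma monomial_series_taylor (R : realType) (b : nat -> R) (e : nat -> nat) (rho : R) :
  fast_decay b e -> 1 <= rho -> exists2 C, 0 <= C & forall z h : R[i]^o,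
  cabs z <= rho -> cabs (h + z) <= rho ->
  cabs (monomial_series b e (h + z) - monomial_series b e z -
    h * monomial_series (fun n => b n * (e n)%:R) (fun n => (e n).-1) z) <= C * cabs h ^+ 2.
Proof.
move=> be r1; have [C HC] : exists C, forall n, `|b n| * (2 * rho) ^+ e n <= geometric C (2^-1) n.
  by apply: be; lra.
have C0 : 0 <= C.
  have := HC 0; rewrite /= expr0 mulr1; apply: le_trans; rewrite mulr_ge0// exprn_ge0//; lra.
exists (2 * C); first lra.
move=> z h zr hr; have be' := fast_decay_deriv be.
have key := @ccvg_le R _ _
  (fun n => series (geometric C (2^-1)) n * cabs h ^+ 2) (2 * C * cabs h ^+ 2)
  _ (cvgB (cvgB (fast_decay_cvg (z := h + z) be) (fast_decay_cvg (z := z) be))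
     (cvgM (cvg_cst h) (fast_decay_cvg (z := z) be'))).
apply: key; last by apply: cvgM; [exact: geometric_half_cvg|exact: cvg_cst].
move=> n; rewrite !fctE /series /= mulr_sumr -!sumrB.
apply: le_trans (cabs_sum _ _ _) _; rewrite mulr_suml; apply: ler_sum => i _.
have -> : (b i)%:C%C * (h + z) ^+ e i - (b i)%:C%C * z ^+ e i -
   h * ((b i * (e i)%:R)%:C%C * z ^+ (e i).-1) = (b i)%:C%C *
    ((h + z) ^+ e i - z ^+ e i - h * ((e i)%:R * z ^+ (e i).-1)).
  by rewrite rmorphM rmorph_nat; ring.
rewrite cabsM cabs_real; apply: le_trans (ler_wpM2l _ (monomial_taylor _ r1 zr hr)) _ => //.
by rewrite mulrCA mulrC ler_wpM2r ?sqr_ge0.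
Qed.

Lemma derive1_monomial_series (R : realType) (b : nat -> R) (e : nat -> nat) :
  fast_decay b e -> derive1 (monomial_series b e) =
     monomial_series (fun n => b n * (e n)%:R) (fun n => (e n).-1).
Proof.
move=> be; apply/funext => z; rewrite /derive1.
have z0 := cabs_ge0 z.
have [|C C0 HC] := @monomial_series_taylor R b e (cabs z + 1) be; first lra.
apply: cvg_lim => //; apply/cvgrPdist_lt => eps eps0.
have [er ei] : 0 < complex.Re eps /\ eps = (complex.Re eps)%:C%C.
  by case: eps eps0 => x y; rewrite ltcE /= => /andP[/eqP -> ?].
pose d := Num.min 1 (complex.Re eps / (C + 1)).
have d0 : 0 < d by rewrite lt_min ltr01 divr_gt0//; lra.
have d0' : 0 < d%:C%C by rewrite ltcR.
near=> h.
have hn0 : h != 0 by near: h; exact: nbhs_dnbhs_neq.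
have hd : cabs h < d.
  rewrite -ltcR -norm_cabs; near: h; apply: dnbhs0_lt; exact: d0'.
rewrite norm_cabs ei ltcR.
have [hd1 hd2] : cabs h < 1 /\ cabs h < complex.Re eps / (C + 1).
  by move: hd; rewrite lt_min => /andP[].
have := HC z h; have := cabsD h z => h1 h2.
have {}h2 := h2 ltac:(lra) ltac:(lra).
have hp : 0 < cabs h.
  rewrite lt_neqAle cabs_ge0 andbT eq_sym; apply: contra_neq hn0.
  exact: Normc.eq0_normc.
rewrite cabs_distC.
have := h2.
have -> : monomial_series b e (h + z) - monomial_series b e z -
   h * monomial_series (fun n => b n * (e n)%:R) (fun n => (e n).-1) z =
   h * (h^-1 *: (monomial_series b e (h + z) - monomial_series b e z) -
    monomial_series (fun n => b n * (e n)%:R) (fun n => (e n).-1) z).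
  by rewrite mulrBr [in RHS]/GRing.scale/= mulrA mulfV// mul1r.
rewrite cabsM expr2 mulrCA ler_pM2l// => h3; apply: le_lt_trans h3 _.
move: hd2; rewrite ltr_pdivlMr; last lra.
apply: le_lt_trans; rewrite mulrC ler_wpM2l//; lra.
Unshelve. all: by end_near. Qed.

(** * Geometrically bounded series and Cauchy products *)

Lemma geometric_partial_sum_le (R : realType) (q : R) n :
  0 <= q -> q < 1 -> \sum_(0 <= i < n) q ^+ i <= (1 - q)^-1.
Proof.
move=> q0 q1; have d0 : 0 < 1 - q by lra.
have -> : \sum_(0 <= i < n) q ^+ i = (1 - q ^+ n) / (1 - q).
  elim: n => [|n IH]; first by rewrite big_nil expr0 subrr mul0r.
  by rewrite big_nat_recr//= IH exprS; field; lra.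
by rewrite ler_pdivrMr// mulVf ?gt_eqF// lerBlDr lerDl exprn_ge0.
Qed.

Lemma geometric_cseries_cvg (R : realType) (a : nat -> R[i]^o) (A q : R) :
  0 <= q -> q < 1 -> (forall n, cabs (a n) <= A * q ^+ n) -> cvgn (series a).
Proof.
move=> q0 q1 aq; apply: (@is_cvg_cseries _ _ (geometric A q)) => //.
by apply: is_cvg_geometric_series; rewrite ger0_norm.
Qed.

Lemma geometric_cseries_tail (R : realType) (a : nat -> R[i]^o) (A q : R) m :
  0 <= q -> q < 1 -> (forall n, cabs (a n) <= A * q ^+ n) ->
  cabs (limn (series a) - series a m) <= A / (1 - q) * q ^+ m.
Proof.
move=> q0 q1 aq; have ca := geometric_cseries_cvg q0 q1 aq.
have A0 : 0 <= A by have := aq 0; rewrite expr0 mulr1; apply: le_trans; exact: cabs_ge0.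
have cs : (series a (n + m)%N @[n --> \oo] --> limn (series a))%classic.
  by rewrite cvg_shiftn.
apply: (@ccvg_le R _ _ (fun=> A / (1 - q) * q ^+ m) _ _ (cvgB cs (cvg_cst (series a m)))).
  move=> n; rewrite !fctE /series /=.
  rewrite (@big_cat_nat _ _ _ m 0 (n + m))//= ?leq_addl// [X in X - _]addrC addrK.
  apply: le_trans (cabs_sum _ _ _) _.
  rewrite -{1}[m]add0n big_addn addnK.
  apply: (@le_trans _ _ (\sum_(0 <= i < n) A * q ^+ m * q ^+ i)).
    by apply: ler_sum => i _; apply: le_trans (aq _) _; rewrite addnC exprD mulrA.
  rewrite -mulr_sumr [leRHS]mulrAC ler_wpM2l ?mulr_ge0 ?exprn_ge0//.
  exact: geometric_partial_sum_le.
exact: cvg_cst.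
Qed.

(** The [N]-th partial sum of the product is [\sum_(i < N) a_i S_(N - i)], where
    [S_k] are the partial sums of [b]. It is close to [limn (series b)] times the
    partial sum of [a], because the tail of [b] after [N - i] terms is
    [O(q^(N - i))]; the factor [2^-i] gained from the faster decay of [a] keeps
    the sum of these errors of order [q^N]. *)
Lemma cauchy_product (R : realType) (a b : nat -> R[i]^o) (A B q : R) :
  0 <= q -> q < 1 ->
  (forall n, cabs (a n) <= A * (q / 2) ^+ n) -> (forall n, cabs (b n) <= B * q ^+ n) ->
  (series (fun n => \sum_(j < n.+1) a j * b (n - j)%N) n @[n --> \oo] -->
    limn (series a) * limn (series b))%classic.
Proof.
move=> q0 q1 aq bq.
pose c : nat -> R[i]^o := fun n => \sum_(j < n.+1) a j * b (n - j)%N; rewrite -/c.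
have h0 : 0 <= q / 2 by lra.
have h1 : q / 2 < 1 by lra.
have ca := geometric_cseries_cvg h0 h1 aq.
have A0 : 0 <= A by have := aq 0; rewrite expr0 mulr1; apply: le_trans; exact: cabs_ge0.
have B0 : 0 <= B by have := bq 0; rewrite expr0 mulr1; apply: le_trans; exact: cabs_ge0.
have cE N : series c N = \sum_(0 <= i < N) a i * series b (N - i)%N.
  elim: N => [|N IH]; first by rewrite /series /= !big_nil.
  have b0 : series b 0 = 0 by rewrite /series /= big_geq.
  rewrite seriesSr IH {1}/c -(big_mkord xpredT (fun j => a j * b (N - j)%N)).
  rewrite [in RHS](eq_big_nat _ _ (F2 := fun i => a i * series b (N - i)%N + a i * b (N - i)%N)).
    rewrite big_split /= [X in _ = X + _]big_nat_recr //= subnn.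
    by rewrite b0 mulr0 addr0.
  by move=> i /andP[_ iN]; rewrite subSn// seriesSr mulrDr.
have d N : cabs (series c N - series a N * limn (series b)) <= 2 * A * (B / (1 - q)) * q ^+ N.
  rewrite cE {2}/series /= mulr_suml -sumrB.
  apply: le_trans (cabs_sum _ _ _) _.
  have e i : (i < N)%N -> cabs (a i * series b (N - i)%N - a i * limn (series b)) <=
      A * (B / (1 - q)) * q ^+ N * (2^-1) ^+ i.
    move=> iN; rewrite -mulrBr cabsM cabs_distC.
    have := ler_pM (cabs_ge0 _) (cabs_ge0 _) (aq i) (geometric_cseries_tail (N - i) q0 q1 bq).
    move=> /le_trans; apply; rewrite exprMn.
    by rewrite -{2}(subnKC (ltnW iN)) exprD le_eqVlt; apply/orP; left; apply/eqP; ring.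
  apply: (@le_trans _ _ (\sum_(0 <= i < N) A * (B / (1 - q)) * q ^+ N * (2^-1) ^+ i)).
    by rewrite !big_nat; apply: ler_sum => i /andP[_ iN]; exact: e.
  rewrite -mulr_sumr.
  have -> : 2 * A * (B / (1 - q)) * q ^+ N = A * (B / (1 - q)) * q ^+ N * (1 - 2^-1)^-1.
    have -> : (1 - 2^-1)^-1 = 2 :> R by field.
    ring.
  rewrite ler_wpM2l ?mulr_ge0 ?exprn_ge0 ?invr_ge0//; first lra.
  by apply: geometric_partial_sum_le; lra.
have z : (series c n - series a n * limn (series b) @[n --> \oo] --> (0 : R[i]^o))%classic.
  apply/ccvgP.
  apply: (@squeeze_cvgr _ _ _ R (fun=> 0) (fun n => 2 * A * (B / (1 - q)) * q ^+ n)).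
  - by apply: nearW => n; rewrite subr0 cabs_ge0; exact: d.
  - exact: cvg_cst.
  - rewrite -[X in (_ --> X)%classic](mulr0 (2 * A * (B / (1 - q)))).
    by apply: cvgM; [exact: cvg_cst|apply: cvg_expr; rewrite ger0_norm].
have -> : series c = (fun n => (series c n - series a n * limn (series b)) +
    series a n * limn (series b)) by apply/funext => n; rewrite subrK.
rewrite -[X in (_ --> X)%classic]add0r.
by apply: (cvgD z); apply: cvgM; [exact: ca|exact: cvg_cst].
Qed.

(** * Formal quotients with nonnegative coefficients *)

Lemma formal_quotient (K : pzRingType) (G u : nat -> K) : G 0 = 1 ->
  exists p : nat -> K, forall n, \sum_(j < n.+1) G j * p (n - j)%N = u n.
Proof.
move=> G0.
pose step n (f : nat -> K) := fun k =>
  if k == n then u n - \sum_(j < n) G j.+1 * f (n - j.+1)%N else f k.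
pose f := fix f n := if n is m.+1 then step m (f m) else fun=> 0.
(* [f n] is final below [n]: step [n] only changes the value at [n]. *)
have stable n d k : (k < n)%N -> f (n + d)%N k = f n k.
  move=> kn; elim: d => [|d IH]; first by rewrite addn0.
  rewrite addnS /= /step ifF// ?IH//; apply/negbTE/eqP => kE.
  by move: kn; rewrite kE ltnNge leq_addr.
exists (fun k => f k.+1 k) => n.
rewrite big_ord_recl /= subn0 G0 mul1r {1}/step eqxx.
rewrite [X in _ + X](_ : _ = \sum_(j < n) G j.+1 * f n (n - j.+1)%N) ?subrK//.
apply: eq_bigr => j _; rewrite /bump /= add1n; congr (_ * _).
have := stable (n - j.+1).+1 j _ (ltnSn _).
by rewrite addSnnS subnK ?ltn_ord// => ->.
Qed.

Lemma alternating_sum_bounds (R : realType) (w : nat -> R) n :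
  (forall i, (i < n)%N -> w i.+1 <= w i) -> (forall i, (i <= n)%N -> 0 <= w i) ->
  0 <= \sum_(i < n.+1) (-1) ^+ i * w i <= w 0.
Proof.
elim: n w => [|n IH] w dec pos.
  by rewrite big_ord_recl big_ord0 /= expr0 mul1r addr0 pos//=.
have /= /andP[h1 h2] := IH (w \o S) (fun i => dec i.+1) (fun i => pos i.+1).
rewrite big_ord_recl /= expr0 mul1r.
rewrite [X in w 0 + X](_ : _ = - \sum_(i < n.+1) (-1) ^+ i * w i.+1); last first.
  by rewrite -sumrN; apply: eq_bigr => i _; rewrite /bump /= add1n exprS mulN1r mulNr.
have d := dec 0 isT; apply/andP; split; lra.
Qed.

(** Nonnegativity of the coefficients [p n] of [- t G' / G], where [G] has the
    alternating coefficients [(-1)^n g_n]. The recurrence expresses [p n] as an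
    alternating sum starting with [g_1 p_(n-1) - g_2 p_(n-2)] and ending with
    [n g_n]. The invariant [3 p_(n-1) <= p n] together with [g_(n+1) <= 3 g_n]
    makes its terms nonincreasing ([n g_n <= 5 g_(n-1)] handles the last one), so
    that [p n] lies between [5 p_(n-1) - g_2 p_(n-2)] and [5 p_(n-1)]; since
    [g_2 <= 9 / 2], the invariant is restored. *)
Lemma quotient_coef_bounds (R : realType) (g p : nat -> R) :
  g 0 = 1 -> g 1 = 5 -> 2 * g 2 <= 9 -> (forall n, 0 < g n) ->
  (forall n, (0 < n)%N -> g n.+1 <= 3 * g n) ->
  (forall n, (0 < n)%N -> n.+1%:R * g n.+1 <= 5 * g n) ->
  (forall n, \sum_(j < n.+1) (-1) ^+ j * g j * p (n - j)%N = (-1) ^+ n.+1 * (n%:R * g n)) ->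
  forall n, 0 <= p n <= 5 ^+ n.
Proof.
move=> g0 g1 g2 gpos g3 gn pE.
have p0 : p 0 = 0.
  by have := pE 0; rewrite big_ord_recl big_ord0 /= expr0 g0 !mul1r addr0 mul0r mulr0.
have p1 : p 1 = 5.
  by have := pE 1; rewrite !big_ord_recl big_ord0 /= !subn0 subnn p0 g0 g1 /=; lra.
suff H n m : (0 < m <= n.+1)%N -> [/\ 0 < p m, p m <= 5 ^+ m & (1 < m)%N -> 3 * p m.-1 <= p m].
  case=> [|n]; first by rewrite p0 expr0 lexx ler01.
  by have [|a b _] := H n n.+1; rewrite ?leqnn// ltW.
elim: n m => [|n IH] m.
  case: m => [|[|m]]//= _; rewrite p1 expr1; split => //; lra.
move=> /andP[m0]; rewrite leq_eqVlt => /orP[/eqP ->|mn]; last by apply: IH; rewrite m0.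
have [pn pn5 pn3] : [/\ 0 < p n.+1, p n.+1 <= 5 ^+ n.+1 & (1 < n.+1)%N -> 3 * p n <= p n.+1].
  by apply: IH; rewrite leqnn.
have IH' k : (0 < k)%N -> (k <= n.+1)%N ->
    [/\ 0 < p k, p k <= 5 ^+ k & (1 < k)%N -> 3 * p k.-1 <= p k].
  by move=> k0 kn; apply: IH; rewrite k0.
(* The last term of the recurrence is [n g_n], as if [p 0] were [n]. *)
pose w j := g j.+1 * (if (j < n.+1)%N then p (n.+1 - j)%N else n.+2%:R).
have wE : p n.+2 = \sum_(j < n.+2) (-1) ^+ j * w j.
  have := pE n.+2; rewrite big_ord_recl /= expr0 g0 !mul1r subn0 => /eqP.
  rewrite eq_sym -subr_eq eq_sym => /eqP ->.
  rewrite big_ord_recr [in RHS]big_ord_recr /= /bump /= !add1n !subnn p0 mulr0 addr0.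
  rewrite /w ltnn addrC; congr (_ + _).
    by rewrite !exprS; ring.
  rewrite -sumrN; apply: eq_bigr => j _.
  have jn := ltn_ord j; rewrite add1n subSS.
  by rewrite jn exprS mulN1r !mulNr opprK mulrA.
have dec i : (i < n.+1)%N -> w i.+1 <= w i.
  rewrite /w => iN; rewrite iN ltnS.
  have := iN; rewrite ltnS leq_eqVlt => /orP[/eqP ->|iN'].
    by rewrite ltnn subSnn p1 mulrC [leRHS]mulrC gn.
  rewrite iN' subSS.
  have ni : (0 < n - i)%N by rewrite subn_gt0.
  have nl : (n - i <= n)%N := leq_subr _ _.
  have [_ _ /(_ ni) h] := IH' (n - i).+1 isT nl.
  have [q0 _ _] := IH' (n - i)%N ni (leqW nl).
  rewrite subSn ?(ltnW iN')//.
  apply: (@le_trans _ _ (3 * g i.+1 * p (n - i)%N)).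
    by rewrite ler_wpM2r ?g3// ltW.
  by rewrite [3 * _]mulrC -mulrA ler_wpM2l// ltW.
have pos i : (i <= n.+1)%N -> 0 <= w i.
  move=> iN; rewrite /w; case: ifP => iN'; last by rewrite mulr_ge0// ltW.
  have [|q0 _ _] := IH' (n.+1 - i)%N _ (leq_subr _ _); first by rewrite subn_gt0.
  by rewrite mulr_ge0// ltW.
have /andP[up0 up] := alternating_sum_bounds dec pos; rewrite -wE in up0 up.
have low : w 0 - w 1 <= p n.+2.
  have /andP[_ /= h] := @alternating_sum_bounds _ (w \o S) n
    (fun i => dec i.+1) (fun i => pos i.+1).
  rewrite wE big_ord_recl /= expr0 mul1r lerD2l lerNl -sumrN; apply: le_trans h.
  by apply: ler_sum => i _; rewrite /bump /= add1n exprS mulN1r mulNr opprK.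
have w0 : w 0 = 5 * p n.+1 by rewrite /w /= subn0 g1.
have w1 : w 1 <= 2 * p n.+1.
  rewrite /w ltnS; case: (posnP n) => [->|n0].
    by rewrite /= p1; lra.
  rewrite subSS subn0; have := pn3 n0 => h.
  have pm : p n <= p n.+1 / 3 by lra.
  have h2 : g 2 * p n <= g 2 * (p n.+1 / 3) by rewrite ler_wpM2l// ltW.
  have h3 : 2 * g 2 * p n.+1 <= 9 * p n.+1 by rewrite ler_wpM2r// ltW.
  by lra.
have s1 : 3 * p n.+1 <= p n.+2 by lra.
split=> //; first by lra.
by apply: le_trans up _; rewrite w0 exprS ler_wpM2l.
Qed.

(** * Normalized coefficients of the Bessel cross-product *)

(** [kappa x n / n.+1] is the ratio of consecutive coefficients of the Bessel
    cross-product after [z^4] is scaled by [16 (nu + 1)_3], where [x = nu + 1]; the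
    scaling makes [kappa x 0 = 1]. *)
Definition kappa (R : realType) (x : R) (i : nat) : R :=
  x * (x + 1) * (x + 2) / ((x + i%:R) * (x + 1 + (2 * i)%:R) * (x + 2 + (2 * i)%:R)).

Definition ncoef (R : realType) (x : R) (n : nat) : R :=
  \prod_(i < n) (kappa x i / i.+1%:R).

Lemma kappa_bounds (R : realType) (x : R) i : 0 < x -> 0 < kappa x i <= 1.
Proof.
move=> x0; have i0 := ler0n R i; rewrite /kappa natrM.
have d0 : 0 < (x + i%:R) * (x + 1 + 2 * i%:R) * (x + 2 + 2 * i%:R).
  by rewrite !mulr_gt0//; lra.
rewrite divr_gt0//=; last by rewrite !mulr_gt0//; lra.
rewrite ler_pdivrMr// mul1r.
have p1 : 0 <= x * i%:R by rewrite mulr_ge0// ltW.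
by do 2 ?[apply: ler_pM; rewrite ?mulr_ge0//]; lra.
Qed.

Lemma ncoefS (R : realType) (x : R) n : ncoef x n.+1 = ncoef x n * (kappa x n / n.+1%:R).
Proof. by rewrite /ncoef big_ord_recr. Qed.

Lemma ncoef0 (R : realType) (x : R) : ncoef x 0 = 1.
Proof. by rewrite /ncoef big_ord0. Qed.

Lemma ncoef_gt0 (R : realType) (x : R) n : 0 < x -> 0 < ncoef x n.
Proof.
move=> x0; rewrite /ncoef; apply: prodr_gt0 => i _.
by have /andP[k0 _] := kappa_bounds i x0; rewrite divr_gt0.
Qed.

Lemma ncoefS_le (R : realType) (x : R) n : 0 < x -> n.+1%:R * ncoef x n.+1 <= ncoef x n.
Proof.
move=> x0; have /andP[k0 k1] := kappa_bounds n x0.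
rewrite ncoefS mulrCA [_%:R * _]mulrC divfK ?pnatr_eq0//.
by rewrite ler_piMr// ltW// ncoef_gt0.
Qed.

Lemma ncoef_small (R : realType) (x : R) : 0 < x ->
  [/\ ncoef x 1 = 1, ncoef x 2 = x * (x + 2) / (2 * (x + 3) * (x + 4)),
    ncoef x 3 = x ^+ 2 * (x + 1) * (x + 2) / (6 * (x + 3) * (x + 4) * (x + 5) * (x + 6)) &
    ncoef x 4 = x ^+ 3 * (x + 1) ^+ 2 * (x + 2) ^+ 2 /
      (24 * (x + 3) ^+ 2 * (x + 4) * (x + 5) * (x + 6) * (x + 7) * (x + 8))].
Proof.
move=> x0.
have h1 : ncoef x 1 = 1.
  by rewrite ncoefS ncoef0 /kappa; field; do ?[apply/andP; split]; lra.
have h2 : ncoef x 2 = x * (x + 2) / (2 * (x + 3) * (x + 4)).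
  by rewrite ncoefS h1 /kappa; field; do ?[apply/andP; split]; lra.
have h3 : ncoef x 3 = x ^+ 2 * (x + 1) * (x + 2) / (6 * (x + 3) * (x + 4) * (x + 5) * (x + 6)).
  by rewrite ncoefS h2 /kappa; field; do ?[apply/andP; split]; lra.
split=> //.
by rewrite ncoefS h3 /kappa; field; do ?[apply/andP; split]; lra.
Qed.

Lemma pochhammer3 (R : realType) (x : R) : pochhammer x 3 = x * (x + 1) * (x + 2).
Proof. by rewrite /pochhammer !big_ord_recr big_ord0 /= mul1r addr0. Qed.

Lemma pochhammerS (R : realType) (a : R) n : pochhammer a n.+1 = pochhammer a n * (a + n%:R).
Proof. by rewrite /pochhammer big_ord_recr. Qed.

Lemma pochhammer_gt0 (R : realType) (a : R) n : 0 < a -> 0 < pochhammer a n.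
Proof. by move=> a0; apply: prodr_gt0 => i _; rewrite ltr_pwDl. Qed.

Lemma bessel_cross_coefE (R : realType) (nu : R) n : -1 < nu ->
  bessel_cross_coef nu n =
  (-1) ^+ n * (16 * pochhammer (nu + 1) 3)^-1 ^+ n * ncoef (nu + 1) n.
Proof.
move=> hnu; rewrite pochhammer3; elim: n => [|n IH].
  by rewrite /bessel_cross_coef /pochhammer ncoef0 !expr0 fact0 !big_ord0 !mulr1 divr1.
have x0 : 0 < nu + 1 by lra.
have n0 := ler0n R n.
pose y := 16 * ((nu + 1) * (nu + 1 + 1) * (nu + 1 + 2)).
have -> : (-1) ^+ n.+1 * y^-1 ^+ n.+1 * ncoef (nu + 1) n.+1 =
    (-1) ^+ n * y^-1 ^+ n * ncoef (nu + 1) n * (- y^-1 * (kappa (nu + 1) n / n.+1%:R)).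
  by rewrite ncoefS !exprS; ring.
rewrite -IH /y /kappa /bessel_cross_coef !mulnS !add2n !pochhammerS factS exprD exprS !natrM.
rewrite -[(2 * n).+1]add1n natrD natrM -[n.+1]add1n natrD.
have A0 : 2 ^+ (4 * n) != 0 :> R by rewrite expf_neq0.
have B0 : (n`!)%:R != 0 :> R by rewrite pnatr_eq0 -lt0n fact_gt0.
have C0 : pochhammer (nu + 1) n != 0 by rewrite gt_eqF// pochhammer_gt0.
have D0 : pochhammer (nu + 2) (2 * n) != 0 by rewrite gt_eqF// pochhammer_gt0//; lra.
move: A0 B0 C0 D0; set A := 2 ^+ _; set B := _%:R; set C := pochhammer _ _; set D := pochhammer _ _.
move=> A0 B0 C0 D0.
by field; rewrite A0 B0 C0 D0 /=; do ?[apply/andP; split]; lra.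
Qed.

(** * Derivatives of the Bessel cross-product *)

(** Up to sign, the coefficients of [G] and [D] of the introduction: termwise,
    [d/dz] and then [d/dz z] multiply [z^(4n+1)] by [4n+1] each. *)
Definition gcoef (R : realType) (x : R) (n : nat) : R := (4 * n + 1)%:R * ncoef x n.
Definition dcoef (R : realType) (x : R) (n : nat) : R := (4 * n + 1)%:R ^+ 2 * ncoef x n.
Definition alt (R : realType) (a : nat -> R) (n : nat) : R := (-1) ^+ n * a n.

Lemma ncoef_le_fact (R : realType) (x : R) n : 0 < x -> ncoef x n <= (n`!)%:R^-1.
Proof.
move=> x0; elim: n => [|n IH]; first by rewrite ncoef0 fact0 invr1.
rewrite factS natrM invfM ler_pdivlMl ?ltr0n//.
exact: le_trans (ncoefS_le n x0) IH.
Qed.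

Lemma exp_coeff_le (R : realType) (y : R) n : 0 <= y -> y ^+ n / (n`!)%:R <= expR y.
Proof.
move=> y0; have := @is_cvg_series_exp_coeff R y => cy.
have nd : nondecreasing_seq (series (exp_coeff y)).
  by apply/nondecreasing_seqP => k; rewrite seriesSr lerDl exp_coeff_ge0.
apply: le_trans (nondecreasing_cvgn_le nd cy n.+1).
rewrite seriesSr /= lerDr; apply: sumr_ge0 => i _; exact: exp_coeff_ge0.
Qed.

Lemma bessel_cross_fast_decay (R : realType) (nu : R) : -1 < nu ->
  fast_decay (bessel_cross_coef nu) (fun n => 4 * n + 1)%N.
Proof.
move=> hnu rho rho1; have x0 : 0 < nu + 1 by lra.
set a1 := (16 * pochhammer (nu + 1) 3)^-1.
have a10 : 0 < a1 by rewrite invr_gt0 mulr_gt0// pochhammer_gt0.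
have r0 : 0 <= rho by lra.
exists (rho * expR (2 * (a1 * rho ^+ 4))) => n.
rewrite bessel_cross_coefE// -/a1 !normrM normrX normrN1 expr1n mul1r.
rewrite (gtr0_norm (ncoef_gt0 _ x0)) (gtr0_norm (exprn_gt0 n a10)).
have h1 := ncoef_le_fact n x0.
have h2 : (2 * (a1 * rho ^+ 4)) ^+ n / (n`!)%:R <= expR (2 * (a1 * rho ^+ 4)).
  by apply: exp_coeff_le; rewrite !mulr_ge0 ?exprn_ge0// ltW.
apply: (@le_trans _ _ (rho * ((2 * (a1 * rho ^+ 4)) ^+ n / (n`!)%:R * 2^-1 ^+ n))); last first.
  by rewrite /= -[X in _ <= X]mulrA ler_wpM2l// ler_wpM2r// exprn_ge0.
rewrite [X in _ <= _ * X]mulrAC -exprMn (_ : 2 * (a1 * rho ^+ 4) / 2 = a1 * rho ^+ 4); last by field.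
rewrite exprMn exprD expr1 exprM.
rewrite (_ : a1 ^+ n * ncoef (nu + 1) n * ((rho ^+ 4) ^+ n * rho) =
  rho * (a1 ^+ n * (rho ^+ 4) ^+ n * ncoef (nu + 1) n)); last by ring.
by rewrite ler_wpM2l// ler_wpM2l// mulr_ge0 ?exprn_ge0// ltW.
Qed.

Lemma bessel_cross_deriv1 (R : realType) (nu : R) (z : R[i]^o) : -1 < nu ->
  derive1 (bessel_cross nu) z = monomial_series (alt (gcoef (nu + 1))) id
     (((16 * pochhammer (nu + 1) 3)^-1)%:C%C * z ^+ 4).
Proof.
move=> hnu.
rewrite (_ : bessel_cross nu = monomial_series (bessel_cross_coef nu) (fun n => 4 * n + 1)%N)//.
rewrite derive1_monomial_series; last exact: bessel_cross_fast_decay.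
congr (limn (series _)); apply/funext => n /=.
rewrite addn1 /= exprMn -exprM mulrA -rmorphXn -rmorphM; congr (_%:C%C * _).
by rewrite bessel_cross_coefE// /alt /gcoef addn1; ring.
Qed.

Lemma bessel_cross_deriv2 (R : realType) (nu : R) (z : R[i]^o) : -1 < nu ->
  derive1 (bessel_cross nu) z + z * derive1n 2 (bessel_cross nu) z =
  monomial_series (alt (dcoef (nu + 1))) id
     (((16 * pochhammer (nu + 1) 3)^-1)%:C%C * z ^+ 4).
Proof.
move=> hnu; have be := bessel_cross_fast_decay hnu.
have be' := fast_decay_deriv be; have be'' := fast_decay_deriv be'.
rewrite (_ : derive1n 2 (bessel_cross nu) = derive1 (derive1 (bessel_cross nu)))//.
rewrite (_ : bessel_cross nu = monomial_series (bessel_cross_coef nu) (fun n => 4 * n + 1)%N)//.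
rewrite derive1_monomial_series// derive1_monomial_series//.
apply/esym/cvg_lim => //.
set t := _%:C%C * _.
have -> : series (fun n => (alt (dcoef (nu + 1)) n)%:C%C * t ^+ n : R[i]^o) =
  fun N => series (fun n =>
      (bessel_cross_coef nu n * (4 * n + 1)%:R)%:C%C * z ^+ (4 * n + 1).-1 : R[i]^o) N
   + z * series (fun n => (bessel_cross_coef nu n * (4 * n + 1)%:R * (4 * n + 1).-1%:R)%:C%C
      * z ^+ (4 * n + 1).-1.-1 : R[i]^o) N.
  apply/funext => N; rewrite /series /= mulr_sumr -big_split /=.
  apply: eq_bigr => n _; rewrite addn1 /= /t exprMn -exprM mulrA -rmorphXn -rmorphM.
  rewrite (_ : z * _ =
    (bessel_cross_coef nu n * (4 * n).+1%:R * (4 * n)%:R)%:C%C * z ^+ (4 * n)); last first.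
    case: n => [|n]; first by rewrite muln0 mulr0 !mul0r mulr0.
    by rewrite mulrCA mulnS add4n /= -exprS.
  rewrite -mulrDl -rmorphD; congr (_%:C%C * _).
  by rewrite bessel_cross_coefE// /alt /dcoef addn1 -natr1; ring.
apply: cvgD; first exact: fast_decay_cvg.
by apply: cvgM; [exact: cvg_cst|exact: fast_decay_cvg].
Qed.

Lemma gcoef_facts (R : realType) (x : R) : 0 < x ->
  [/\ gcoef x 0 = 1, gcoef x 1 = 5, 2 * gcoef x 2 <= 9, (forall n, 0 < gcoef x n) &
   forall n, (0 < n)%N -> n.+1%:R * gcoef x n.+1 <= 5 * gcoef x n /\ gcoef x n.+1 <= gcoef x n].
Proof.
move=> x0; have [n1 n2 n3 n4] := ncoef_small x0.
split.
- by rewrite /gcoef ncoef0 mulr1.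
- by rewrite /gcoef n1 mulr1.
- have := ncoefS_le 1 x0; rewrite /gcoef n1; lra.
- by move=> n; rewrite /gcoef mulr_gt0 ?ncoef_gt0// ltr0n addn1.
move=> n n0; rewrite /gcoef !natrD !natrM -[n.+1]addn1 !natrD.
have h := ncoefS_le n x0; have p := ncoef_gt0 n x0; have q := ncoef_gt0 n.+1 x0.
move: h; rewrite -[n.+1]addn1 natrD addn1.
have n1' : 1 <= n%:R :> R by rewrite ler1n.
move: p q; set m := n%:R; set a := ncoef x n; set b := ncoef x n.+1 => p q h.
have h' : (4 * m + 5) * ((m + 1) * b) <= (4 * m + 5) * a by rewrite ler_wpM2l//; rewrite /m; lra.
have h3 : 0 <= (m - 1) * a by apply: mulr_ge0; lra.
have h4 : 0 <= (m - 1) * b by apply: mulr_ge0; lra.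
split; first by lra.
have h5 : (4 * m + 1) * ((m + 1) * b) <= (4 * m + 1) * a by rewrite ler_wpM2l//; lra.
have h6 : 0 <= m * ((m - 1) * b) by apply: mulr_ge0; lra.
lra.
Qed.

(** * The quotient of the two derivative series *)

(** The remainder of an alternating series has the sign of its first term; only
    the terms from index [m] on have to decrease. *)
Lemma alternating_series_remainder (R : realType) (d : nat -> R) (l : R) m :
  (forall n, 0 <= d n) -> (forall n, (m <= n)%N -> d n.+1 <= d n) ->
  (series (alt d) n @[n --> \oo] --> l)%classic ->
  0 <= (-1) ^+ m * (l - series (alt d) m).
Proof.
move=> d0 dec dl.
have dl' : (series (alt d) (n + m)%N @[n --> \oo] --> l)%classic by rewrite cvg_shiftn.
have lim : ((-1) ^+ m * (series (alt d) (n + m)%N - series (alt d) m) @[n --> \oo] -->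
    (-1) ^+ m * (l - series (alt d) m))%classic.
  by apply: cvgM; [exact: cvg_cst|apply: cvgB => //; exact: cvg_cst].
have z : ((0 : R) @[n --> \oo] --> (0 : R))%classic by exact: cvg_cst.
apply: (ler_cvg_to z lim); apply: nearW => n /=.
rewrite series_addn [_ + \sum_(_ <= _ < _) _]addrC addrK.
rewrite -{2}[m]add0n big_addn addnK big_mkord mulr_sumr.
case: n => [|n]; first by rewrite big_ord0.
have /andP[h _] := @alternating_sum_bounds R (fun i => d (i + m)%N) n
  (fun i _ => dec (i + m)%N (leq_addl _ _)) (fun i _ => d0 (i + m)%N).
apply: le_trans h _; apply: ler_sum => i _.
by rewrite /alt exprD mulrA mulrCA -expr2 sqrr_sign mulr1.
Qed.

Lemma monomial_series_real (R : realType) (b : nat -> R) (T : R) :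
  cvgn (series (fun n => b n * T ^+ n)) ->
  monomial_series b id T%:C%C = (limn (series (fun n => b n * T ^+ n)))%:C%C.
Proof.
move=> cb; apply: cvg_lim => //.
have -> : series (fun n => (b n)%:C%C * T%:C%C ^+ n : R[i]^o) =
    (fun N => (series (fun n => b n * T ^+ n) N)%:C%C).
  apply/funext => N; rewrite /series /= rmorph_sum /=.
  by apply: eq_bigr => n _; rewrite rmorphM rmorphXn.
exact: ccvg_real.
Qed.

Lemma geometric_rseries_cvg (R : realType) (u : nat -> R) (A q : R) :
  0 <= q -> q < 1 -> (forall n, `|u n| <= A * q ^+ n) -> cvgn (series u).
Proof.
move=> q0 q1 uq; apply: (@normed_cvg _ R^o).
apply: (@series_le_cvg _ _ (geometric A q)) => //.
- by move=> n /=.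
- by move=> n; exact: le_trans (normr_ge0 _) (uq n).
- by apply: is_cvg_geometric_series; rewrite ger0_norm.
Qed.

Lemma gcoef_le (R : realType) (x : R) n : 0 < x -> gcoef x n <= 5.
Proof.
move=> x0; have [g0 g1 _ _ gS] := gcoef_facts x0.
case: n => [|n]; first by rewrite g0; lra.
by elim: n => [|n IH]; [rewrite g1|apply: le_trans IH; have [] := gS n.+1 isT].
Qed.

Lemma dcoefS_le (R : realType) (x : R) n : 0 < x -> (0 < n)%N -> dcoef x n.+1 <= 2 * dcoef x n.
Proof.
move=> x0 n0; have h := ncoefS_le n x0.
have p := ncoef_gt0 n x0; have q := ncoef_gt0 n.+1 x0.
have n1 : 1 <= n%:R :> R by rewrite ler1n.
have e k : (4 * k + 1)%:R = 4 * k%:R + 1 :> R by rewrite natrD natrM.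
rewrite /dcoef !e; move: p q h; rewrite -natr1.
set m := n%:R; set a := ncoef x n; set b := ncoef x n.+1 => p q h.
have h1 : 0 <= (m - 1) * b by apply: mulr_ge0; lra.
have h2 : 2 * b <= a by lra.
apply: (@le_trans _ _ ((2 * (4 * m + 1)) ^+ 2 * b)).
  by rewrite (ler_wpM2r (ltW q))// lerXn2r// ?nnegrE; lra.
rewrite (_ : (2 * (4 * m + 1)) ^+ 2 * b = (4 * m + 1) ^+ 2 * (4 * b)); last by ring.
by rewrite [X in _ <= X]mulrCA ler_wpM2l ?sqr_ge0//; lra.
Qed.

Lemma dcoef_le (R : realType) (x : R) n : 0 < x -> 0 < dcoef x n <= 25 * 2 ^+ n.
Proof.
move=> x0; rewrite mulr_gt0 ?ncoef_gt0 ?exprn_gt0 ?ltr0n ?addn1//=.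
have [n1 _ _ _] := ncoef_small x0.
case: n => [|n]; first by rewrite /dcoef ncoef0 expr0 mulr1; lra.
elim: n => [|n IH]; first by rewrite /dcoef n1 expr1 mulr1; lra.
by apply: le_trans (dcoefS_le x0 (ltn0Sn n)) _; rewrite exprS; lra.
Qed.

(** The identity [D = G (1 - 4 Q)]: the recurrence of the [p n] says that
    [G Q = - t G'], and [D = G + 4 t G']. *)
Lemma log_derivative_quotient (R : realType) (x : R) : 0 < x ->
  exists2 p : nat -> R, (forall n, 0 <= p n <= 5 ^+ n) &
  forall t : R[i]^o, cabs t <= 10^-1 ->
    monomial_series (alt (gcoef x)) id t - monomial_series (alt (dcoef x)) id t =
    4 * (monomial_series (alt (gcoef x)) id t * monomial_series p id t).
Proof.
move=> x0; have [g0 g1 g2 gpos gS] := gcoef_facts x0.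
have [p pE] := @formal_quotient R (alt (gcoef x)) (fun n => (-1) ^+ n.+1 * (n%:R * gcoef x n))
  ltac:(by rewrite /alt g0 expr0 mulr1).
have pb : forall n, 0 <= p n <= 5 ^+ n.
  apply: (quotient_coef_bounds g0 g1 g2 gpos) => // n n0; have [a b] := gS n n0 => //.
  by have := gpos n; lra.
exists p => // t ht; have t0 := cabs_ge0 t.
have aq n : cabs ((alt (gcoef x) n)%:C%C * t ^+ n) <= 5 * (2^-1 / 2) ^+ n.
  rewrite cabsM cabsX cabs_real /alt normrM normrX normrN1 expr1n mul1r gtr0_norm//.
  apply: ler_pM; [exact: ltW|exact: exprn_ge0|exact: gcoef_le|].
  by rewrite lerXn2r// ?nnegrE; lra.
have bq n : cabs ((p n)%:C%C * t ^+ n) <= 1 * 2^-1 ^+ n.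
  have /andP[pn0 pn] := pb n.
  rewrite cabsM cabsX cabs_real ger0_norm// mul1r.
  rewrite (_ : 2^-1 = 5 * 10^-1); last by field.
  by rewrite exprMn; apply: ler_pM; rewrite ?exprn_ge0// lerXn2r// ?nnegrE; lra.
have dq n : cabs ((alt (dcoef x) n)%:C%C * t ^+ n) <= 25 * 5^-1 ^+ n.
  have /andP[dn0 dn] := dcoef_le n x0.
  rewrite cabsM cabsX cabs_real /alt normrM normrX normrN1 expr1n mul1r gtr0_norm//.
  rewrite (_ : 5^-1 = 2 * 10^-1); last by field.
  rewrite exprMn mulrA; apply: ler_pM => //; [exact: ltW|exact: exprn_ge0|].
  by rewrite lerXn2r// ?nnegrE; lra.
have h12 : 0 <= 2^-1 :> R by lra.
have h12' : 2^-1 < 1 :> R by lra.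
have prod := cauchy_product h12 h12' aq bq.
have cg : cvgn (series (fun n => (alt (gcoef x) n)%:C%C * t ^+ n : R[i]^o)).
  by apply: geometric_cseries_cvg aq; lra.
have cd : cvgn (series (fun n => (alt (dcoef x) n)%:C%C * t ^+ n : R[i]^o)).
  by apply: geometric_cseries_cvg dq; lra.
set sg := series _ in cg; set sd := series _ in cd.
set sp := series _ in prod.
have lim1 : (sg n - sd n @[n --> \oo] --> limn sg - limn sd)%classic.
  exact: (cvgB cg cd).
have lim2 := cvgM (cvg_cst (4 : R[i]^o)) prod.
have {}lim2 : ((4 : R[i]^o) * sp n @[n --> \oo] -->
    4 * (monomial_series (alt (gcoef x)) id t * monomial_series p id t))%classic by exact: lim2.
have E : (fun n => sg n - sd n) = (fun n => 4 * sp n).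
  apply/funext => N.
  rewrite /sg /sd /sp /series /= mulr_sumr -sumrB; apply: eq_bigr => n _.
  have -> : \sum_(j < n.+1) (alt (gcoef x) j)%:C%C * t ^+ j * ((p (n - j)%N)%:C%C * t ^+ (n - j)) =
     ((-1) ^+ n.+1 * (n%:R * gcoef x n))%:C%C * t ^+ n.
    rewrite -pE rmorph_sum mulr_suml; apply: eq_bigr => j _ /=.
    have -> : t ^+ n = t ^+ j * t ^+ (n - j) by rewrite -exprD subnKC// -ltnS.
    by rewrite [in RHS]rmorphM /=; ring.
  rewrite -mulrBl mulrA -rmorphB; congr (_ * _).
  rewrite (_ : 4 = (4 : R)%:C%C) -?rmorphM; last by rewrite rmorph_nat.
  congr (_%:C%C); have e : (4 * n + 1)%:R = 4 * n%:R + 1 :> R by rewrite natrD natrM.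
  by rewrite /alt /dcoef /gcoef e (exprS (-1)); ring.
by rewrite -(cvg_lim (@norm_hausdorff _ _) lim2) -E (cvg_lim (@norm_hausdorff _ _) lim1).
Qed.

(** * Positivity of the real part on disks and its failure at real points *)

(** Shows at once that [G] has no zero in the disk and is positive at its real
    points. *)
Lemma gseries_near1 (R : realType) (x : R) (t : R[i]^o) : 0 < x -> cabs t <= 10^-1 ->
  cabs (monomial_series (alt (gcoef x)) id t - 1) < 1.
Proof.
move=> x0 ht; have t0 := cabs_ge0 t; have [g0 _ _ gpos _] := gcoef_facts x0.
have aq n : cabs ((alt (gcoef x) n)%:C%C * t ^+ n) <= 5 * 10^-1 ^+ n.
  rewrite cabsM cabsX cabs_real /alt normrM normrX normrN1 expr1n mul1r gtr0_norm//.
  apply: ler_pM; [exact: ltW|exact: exprn_ge0|exact: gcoef_le|].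
  by rewrite lerXn2r// ?nnegrE; lra.
have q0 : 0 <= 10^-1 :> R by lra.
have q1 : 10^-1 < 1 :> R by lra.
have := geometric_cseries_tail 1 q0 q1 aq.
rewrite {2}/series /= big_nat1 /alt g0 !expr0 !mulr1 => h; apply: le_lt_trans h _.
rewrite expr1 (_ : 5 / (1 - 10^-1) * 10^-1 = 5 / 9); [lra|by field].
Qed.

(** Partial sum of degree 3 of [D]. *)
Definition dsum3 (R : realType) (x T : R) : R :=
  1 - 25 * T + 81 * ncoef x 2 * T ^+ 2 - 169 * ncoef x 3 * T ^+ 3.

(** The radius [1 / 10] guarantees that the terms decrease from index 1 on: their
    ratio is at most twice the radius. *)
Lemma dseries_bounds (R : realType) (x T : R) : 0 < x -> 0 < T <= 10^-1 ->
  exists2 D : R, monomial_series (alt (dcoef x)) id T%:C%C = D%:C%C &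
    dsum3 x T <= D <= dsum3 x T + 289 * ncoef x 4 * T ^+ 4.
Proof.
move=> x0 /andP[T0 T1]; have [n1 _ _ _] := ncoef_small x0.
pose d n := dcoef x n * T ^+ n.
have d0 n : 0 <= d n.
  by have /andP[h _] := dcoef_le n x0; rewrite mulr_ge0 ?exprn_ge0// ltW.
have dec n : (0 < n)%N -> d n.+1 <= d n.
  move=> n0; have h := dcoefS_le x0 n0; have /andP[h' _] := dcoef_le n.+1 x0.
  have T2 : 0 < T ^+ n by exact: exprn_gt0.
  rewrite /d exprS; apply: (@le_trans _ _ (2 * dcoef x n * (10^-1 * T ^+ n))).
    by apply: ler_pM => //; [exact: ltW|rewrite mulr_ge0 // ltW|rewrite ler_wpM2r// ltW].
  have : 0 <= dcoef x n * T ^+ n by exact: d0.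
  lra.
have dE : (fun n => alt (dcoef x) n * T ^+ n) = alt d.
  by apply/funext => n; rewrite /alt /d -mulrA.
have cd : cvgn (series (alt d)).
  apply: (@geometric_rseries_cvg _ _ 25 5^-1); try lra.
  move=> n; rewrite /alt normrM normrX normrN1 expr1n mul1r ger0_norm// /d.
  have /andP[h h'] := dcoef_le n x0.
  rewrite (_ : 5^-1 = 2 * 10^-1); last by field.
  rewrite exprMn mulrA; apply: ler_pM => //; [exact: ltW|rewrite exprn_ge0//|]; try lra.
  by rewrite lerXn2r// ?nnegrE; lra.
exists (limn (series (alt d))).
  by rewrite monomial_series_real dE.
have r4 := @alternating_series_remainder _ d _ 4 d0 (fun n h => dec n (leq_trans _ h)) cd.
have r5 := @alternating_series_remainder _ d _ 5 d0 (fun n h => dec n (leq_trans _ h)) cd.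
move: (r4 isT) (r5 isT); rewrite !seriesSr [series _ 0]big_nil /alt /d /dcoef n1 ncoef0 /dsum3 /=.
rewrite !expr0 => h4 h5; apply/andP; split; lra.
Qed.

(** Since [Q] has nonnegative coefficients, [|Q(t)| <= Q(T)], and
    [1 - 4 Q(T) = D(T) / G(T)] is positive. *)
Lemma convex_disk (R : realType) (x T : R) (t : R[i]^o) : 0 < x -> 0 < T <= 10^-1 ->
  0 < dsum3 x T -> cabs t <= T ->
  monomial_series (alt (gcoef x)) id t != 0 /\
  0 < complex.Re (monomial_series (alt (dcoef x)) id t / monomial_series (alt (gcoef x)) id t).
Proof.
move=> x0 Tb d3 tT; have /andP[T0 T1] := Tb.
have cT : cabs T%:C%C = T by rewrite cabs_real gtr0_norm.
have [p pb pE] := log_derivative_quotient x0.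
have G1 s : cabs s <= 10^-1 -> monomial_series (alt (gcoef x)) id s != 0.
  move=> hs; apply/eqP => E; have := gseries_near1 x0 hs.
  by rewrite E sub0r cabsN cabs_real normr1 ltxx.
have Gt := G1 _ (le_trans tT T1); split=> //.
have quot s : cabs s <= 10^-1 ->
    monomial_series (alt (dcoef x)) id s / monomial_series (alt (gcoef x)) id s
    = 1 - 4 * monomial_series p id s.
  move=> hs; have G0 := G1 _ hs; have := pE _ hs; set G := monomial_series _ _ _.
  set D := monomial_series _ _ _; set P := monomial_series _ _ _ => E.
  have -> : D = G - 4 * (G * P) by rewrite -E opprB addrC subrK.
  by field.
have pq s : cabs s <= 10^-1 -> forall n, cabs ((p n)%:C%C * s ^+ n) <= 1 * 2^-1 ^+ n.
  move=> hs n; have /andP[pn0 pn] := pb n; have s0 := cabs_ge0 s.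
  rewrite cabsM cabsX cabs_real ger0_norm// mul1r.
  rewrite (_ : 2^-1 = 5 * 10^-1); last by field.
  by rewrite exprMn; apply: ler_pM; rewrite ?exprn_ge0// lerXn2r// ?nnegrE; lra.
have cp : cvgn (series (fun n => p n * T ^+ n)).
  apply: (@geometric_rseries_cvg _ _ 1 2^-1); try lra.
  by move=> n; have := pq T%:C%C; rewrite cT => /(_ T1 n); rewrite -rmorphXn -rmorphM cabs_real.
have PT := monomial_series_real cp.
set QT := limn _ in PT.
have Pt : cabs (monomial_series p id t) <= QT.
  apply: (ccvg_le _ _ cp); last first.
    have h0 : 0 <= 2^-1 :> R by lra.
    have h1 : 2^-1 < 1 :> R by lra.
    exact: (geometric_cseries_cvg h0 h1 (pq t (le_trans tT T1))).
  move=> n; apply: le_trans (cabs_sum _ _ _) _; apply: ler_sum => i _.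
  have /andP[pn0 pn] := pb i.
  rewrite cabsM cabsX cabs_real ger0_norm// ler_wpM2l// lerXn2r// ?nnegrE ?cabs_ge0//; lra.
have [D DE /andP[D3 _]] := dseries_bounds x0 Tb.
have QT1 : 0 < 1 - 4 * QT.
  have h : cabs T%:C%C <= 10^-1 by rewrite cT.
  have ReG : 0 < complex.Re (monomial_series (alt (gcoef x)) id T%:C%C).
    have := le_lt_trans (cabs_Re _) (gseries_near1 x0 h).
    by rewrite raddfB /= ltr_norml => /andP[]; lra.
  have := quot _ h; rewrite DE PT => E.
  have : D%:C%C = (1 - 4 * QT)%:C%C * monomial_series (alt (gcoef x)) id T%:C%C.
    have -> : (1 - 4 * QT)%:C%C = 1 - 4 * QT%:C%C by rewrite rmorphB rmorph1 rmorphM rmorph_nat.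
    by rewrite -E; apply/esym/divfK; exact: (G1 _ h).
  move/(congr1 (@complex.Re R)); case: (monomial_series _ _ _) ReG => a b /= ReG.
  rewrite mul0r subr0 => DE'.
  by rewrite -(pmulr_lgt0 _ ReG) -DE'; lra.
rewrite quot; last exact: le_trans tT T1.
have := le_trans (cabs_Re _) Pt; rewrite ler_norml => /andP[_ h].
have -> : complex.Re (1 - 4 * monomial_series p id t) = 1 - 4 * complex.Re (monomial_series p id t).
  rewrite (_ : 4 = (4 : R)%:C%C); last by rewrite rmorph_nat.
  by case: (monomial_series _ _ _) => a b /=; rewrite mul0r subr0.
lra.
Qed.

Lemma nonconvex_point (R : realType) (x T : R) : 0 < x -> 0 < T <= 10^-1 ->
  dsum3 x T + 289 * ncoef x 4 * T ^+ 4 <= 0 ->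
  monomial_series (alt (gcoef x)) id T%:C%C != 0 ->
  complex.Re (monomial_series (alt (dcoef x)) id T%:C%C /
    monomial_series (alt (gcoef x)) id T%:C%C) <= 0.
Proof.
move=> x0 Tb d4 G0; have /andP[T0 T1] := Tb; have [_ _ _ gpos _] := gcoef_facts x0.
have cg : cvgn (series (fun n => alt (gcoef x) n * T ^+ n)).
  apply: (@geometric_rseries_cvg _ _ 5 10^-1); try lra.
  move=> n; rewrite /alt 2!normrM !normrX normrN1 expr1n mul1r (gtr0_norm (gpos n)) (gtr0_norm T0).
  apply: ler_pM; [exact: ltW|apply: exprn_ge0; lra|exact: gcoef_le|].
  by rewrite lerXn2r// ?nnegrE; lra.
have [D -> /andP[_ D4]] := dseries_bounds x0 Tb.
have h : cabs T%:C%C <= 10^-1 by rewrite cabs_real gtr0_norm.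
have := le_lt_trans (cabs_Re _) (gseries_near1 x0 h).
rewrite (monomial_series_real cg); set G := limn _.
rewrite raddfB => hG.
have {hG} G1 : - 1 < G - 1 by move: hG; rewrite /= ltr_norml => /andP[].
have -> : (D%:C%C : R[i]^o) / (G%:C%C : R[i]^o) = (D / G)%:C%C by rewrite rmorphM fmorphV.
rewrite /= mulr_le0_ge0//; first lra.
by rewrite invr_ge0; lra.
Qed.

(** * Polynomial inequalities for the extremal truncations *)

(** Cleared form of the negativity of the partial sum of degree 4 of [D] at
    [T = N / M]. The left-hand side is a polynomial in [x] of degree 23 all of whose
    nonzero coefficients are negative, and linear arithmetic over the powers of [x]
    decides it. *)
Lemma upper_poly (R : realType) (x : R) : 0 < x ->
  let N := (x + 5) * (x + 6) * (544 * x ^+ 2 + (4 * 1000 + 213) * x + 7500) in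
  let M := 6 * (2112 * x ^+ 4 + (40 * 1000 + 336) * x ^+ 3 + (283 * 1000 + 599) * x ^+ 2 +
    (860 * 1000 + 250) * x + (937 * 1000 + 500)) in
  24 * M ^+ 4 * ((x + 3) ^+ 2 * (x + 4) * (x + 5) * (x + 6) * (x + 7) * (x + 8))
  - 600 * N * M ^+ 3 * ((x + 3) ^+ 2 * (x + 4) * (x + 5) * (x + 6) * (x + 7) * (x + 8))
  + 972 * N ^+ 2 * M ^+ 2 * (x * (x + 2) * (x + 3) * (x + 5) * (x + 6) * (x + 7) * (x + 8))
  - 676 * N ^+ 3 * M * (x ^+ 2 * (x + 1) * (x + 2) * (x + 3) * (x + 7) * (x + 8))
  + 289 * N ^+ 4 * (x ^+ 3 * (x + 1) ^+ 2 * (x + 2) ^+ 2) < 0.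
Proof.
move=> x0 /=.
have p k : 0 < x ^+ k by exact: exprn_gt0.
have p2 := p 2; have p3 := p 3; have p4 := p 4; have p5 := p 5; have p6 := p 6; have p7 := p 7.
have p8 := p 8; have p9 := p 9; have p10 := p 10; have p11 := p 11; have p12 := p 12.
have p13 := p 13; have p14 := p 14; have p15 := p 15; have p16 := p 16; have p17 := p 17.
have p18 := p 18; have p19 := p 19; have p20 := p 20; have p21 := p 21; have p22 := p 22; have p23 := p 23.
lra.
Qed.

(** Cleared form of [T^2 (25 + 169 c_3 T^2)^2 < (1 + 81 c_2 T^2)^2] at
    [T^2 = (x + 3) (x + 4) / n13]. *)
Lemma lower_poly (R : realType) (x : R) : 0 < x ->
  let n13 := 544 * x ^+ 2 + (4 * 1000 + 213) * x + 7500 in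
  (x + 3) * (x + 4) * (150 * ((x + 5) * (x + 6)) * n13 + 169 * (x ^+ 2 * (x + 1) * (x + 2))) ^+ 2 <
  36 * ((x + 5) * (x + 6)) ^+ 2 * (n13 + 81 * x * (x + 2) / 2) ^+ 2 * n13.
Proof.
move=> x0 /=.
have p k : 0 < x ^+ k by exact: exprn_gt0.
have p2 := p 2; have p3 := p 3; have p4 := p 4; have p5 := p 5; have p6 := p 6; have p7 := p 7.
have p8 := p 8; have p9 := p 9; have p10 := p 10.
lra.
Qed.

Lemma dsum4_lt0 (R : realType) (nu : R) : -1 < nu ->
  let T := (nu + 6) * (nu + 7) * nu13 nu / (6 * nu14 nu) in
  dsum3 (nu + 1) T + 289 * ncoef (nu + 1) 4 * T ^+ 4 < 0.
Proof.
move=> hnu /=.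
set x := nu + 1; have x0 : 0 < x by rewrite /x; lra.
have -> : nu + 6 = x + 5 by rewrite /x; ring.
have -> : nu + 7 = x + 6 by rewrite /x; ring.
have -> : nu13 nu = 544 * x ^+ 2 + (4 * 1000 + 213) * x + 7500 by rewrite /nu13 /x; ring.
have -> : nu14 nu = 2112 * x ^+ 4 + (40 * 1000 + 336) * x ^+ 3 + (283 * 1000 + 599) * x ^+ 2 +
    (860 * 1000 + 250) * x + (937 * 1000 + 500) by rewrite /nu14 /x; ring.
move: x x0 => x x0.
have := upper_poly x0; move=> /=.
set N := (x + 5) * (x + 6) * _; set M := 6 * _ => h.
have M0 : 0 < M.
  by have := exprn_gt0 2 x0; have := exprn_gt0 3 x0; have := exprn_gt0 4 x0; rewrite /M; lra.
move: N M h M0 => N M h M0.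
have L0 : 0 < 24 * M ^+ 4 * ((x + 3) ^+ 2 * (x + 4) * (x + 5) * (x + 6) * (x + 7) * (x + 8)).
  by rewrite !mulr_gt0 ?exprn_gt0//; lra.
rewrite -(pmulr_rlt0 _ L0); apply: le_lt_trans h.
have [_ n2 n3 n4] := ncoef_small x0; rewrite /dsum3 n2 n3 n4.
rewrite le_eqVlt; apply/orP; left; apply/eqP.
by field; do ?[apply/andP; split]; lra.
Qed.

(** The value [T] is a square root, so the even and odd parts of the partial sum are
    separated and compared through their squares, which are rational in [nu]. *)
Lemma dsum3_gt0 (R : realType) (nu T : R) : -1 < nu -> 0 < T ->
  T ^+ 2 = (nu + 4) * (nu + 5) / nu13 nu -> 0 < dsum3 (nu + 1) T.
Proof.
move=> hnu T0.
set x := nu + 1; have x0 : 0 < x by rewrite /x; lra.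
have -> : nu + 4 = x + 3 by rewrite /x; ring.
have -> : nu + 5 = x + 4 by rewrite /x; ring.
have -> : nu13 nu = 544 * x ^+ 2 + (4 * 1000 + 213) * x + 7500 by rewrite /nu13 /x; ring.
move: x x0 => x x0.
have := lower_poly x0; move=> /=; set m := 544 * _ + _ + _ => h T2.
have m0 : 0 < m by have := exprn_gt0 2 x0; rewrite /m; lra.
have [_ n2 n3 _] := ncoef_small x0.
have c2T : 0 < ncoef x 2 * T ^+ 2 by rewrite mulr_gt0 ?exprn_gt0// ncoef_gt0.
have c3T : 0 < ncoef x 3 * T ^+ 2 by rewrite mulr_gt0 ?exprn_gt0// ncoef_gt0.
have A0 : 0 < 1 + 81 * ncoef x 2 * T ^+ 2 by lra.
have B0 : 0 < 25 + 169 * ncoef x 3 * T ^+ 2 by lra.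
have -> : dsum3 x T = 1 + 81 * ncoef x 2 * T ^+ 2 - T * (25 + 169 * ncoef x 3 * T ^+ 2).
  by rewrite /dsum3; ring.
rewrite subr_gt0 -(ltr_pXn2r (n := 2))// ?nnegrE ?ltW ?mulr_gt0//.
rewrite exprMn T2 n2 n3.
move: m h T2 m0 => m h T2 m0.
have L0 : 0 < 36 * ((x + 5) * (x + 6)) ^+ 2 * m ^+ 3.
  by rewrite mulr_gt0 ?exprn_gt0// mulr_gt0 ?exprn_gt0// mulr_gt0//; lra.
rewrite -(ltr_pM2l L0); apply: le_lt_trans (lt_le_trans h _).
  by rewrite le_eqVlt; apply/orP; left; apply/eqP; field; do ?[apply/andP; split]; lra.
by rewrite le_eqVlt; apply/orP; left; apply/eqP; field; do ?[apply/andP; split]; lra.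
Qed.

(** * From the quotient to the radius of convexity *)

Lemma horner_lt0_left (R : realType) (p : {poly R}) (X : R) : 0 < X -> p.[X] < 0 ->
  exists2 T, 0 < T < X & p.[T] < 0.
Proof.
move=> X0 pX.
have pc : (p.[T] @[T --> X^'-] --> p.[X])%classic.
  by apply: cvg_at_left_filter; exact: continuous_horner.
near (X^'-)%classic => T; exists T; last by near: T; exact: (cvgr_lt _ pc).
by apply/andP; split; near: T; [exact: nbhs_left_gt|exact: nbhs_left_lt].
Unshelve. all: by end_near. Qed.

Lemma horner_gt0_right (R : realType) (p : {poly R}) (X Y : R) : X < Y -> 0 < p.[X] ->
  exists2 T, X < T < Y & 0 < p.[T].
Proof.
move=> XY pX.
have pc : (p.[T] @[T --> X^'+] --> p.[X])%classic.
  by apply: cvg_at_right_filter; exact: continuous_horner.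
near (X^'+)%classic => T; exists T; last by near: T; exact: (cvgr_gt _ pc).
by apply/andP; split; near: T; [exact: nbhs_right_gt|exact: nbhs_right_lt].
Unshelve. all: by end_near. Qed.

Lemma powR_rootK (R : realType) (y : R) n : (0 < n)%N -> 0 <= y -> (y `^ n%:R^-1) ^+ n = y.
Proof.
move=> n0 y0; rewrite -powR_mulrn ?powR_ge0// -powRrM mulVf ?powRr1//.
by rewrite pnatr_eq0 -lt0n.
Qed.

Lemma ltr_root4 (R : realType) (y z : R) : 0 <= y -> y < z -> y `^ 4^-1 < z `^ 4^-1.
Proof. by move=> y0 yz; apply: gt0_ltr_powR; rewrite ?nnegrE ?invr_gt0//; lra. Qed.

Lemma mulr2_root4 (R : realType) (y : R) : 0 <= y -> 2 * y `^ 4^-1 = (16 * y) `^ 4^-1.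
Proof.
move=> y0; apply: (@pexpIrn R 4) => //; rewrite ?nnegrE ?mulr_ge0 ?powR_ge0//.
by rewrite exprMn !powR_rootK//; [ring|rewrite mulr_ge0].
Qed.

(** The condition fails at the real point with fourth power [16 (nu + 1)_3 T]. *)
Lemma radius_of_convexity_le (R : realType) (nu T : R) : -1 < nu -> 0 < T <= 10^-1 ->
  dsum3 (nu + 1) T + 289 * ncoef (nu + 1) 4 * T ^+ 4 <= 0 ->
  (radius_of_convexity (bessel_cross nu) <=
    ((16 * pochhammer (nu + 1) 3 * T) `^ 4^-1)%:E)%E.
Proof.
move=> hnu Tb d4; have /andP[T0 T1] := Tb; have x0 : 0 < nu + 1 by lra.
set a := 16 * pochhammer (nu + 1) 3; have a0 : 0 < a by rewrite mulr_gt0// pochhammer_gt0.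
set rho := _ `^ _.
apply: ge_ereal_sup => _ [r [r0 conv] <-]; rewrite lee_fin leNgt; apply/negP => rho_r.
have [|G0 D0] := conv rho%:C%C.
  by rewrite norm_cabs ltcR cabs_real ger0_norm// powR_ge0.
have aE : (a^-1)%:C%C * rho%:C%C ^+ 4 = T%:C%C :> R[i].
  rewrite -rmorphXn -rmorphM; congr (_%:C%C).
  rewrite powR_rootK//; last by rewrite mulr_ge0// ltW.
  by rewrite mulKf// gt_eqF.
have e1 := @bessel_cross_deriv1 R nu rho%:C%C hnu.
have e2 := @bessel_cross_deriv2 R nu rho%:C%C hnu.
rewrite aE in e1 e2.
have := nonconvex_point x0 Tb d4; rewrite -e1 -e2 mulrDl divff// => /(_ G0).
by rewrite leNgt D0.
Qed.

Lemma radius_of_convexity_ge (R : realType) (nu T : R) : -1 < nu -> 0 < T <= 10^-1 ->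
  0 < dsum3 (nu + 1) T ->
  (((16 * pochhammer (nu + 1) 3 * T) `^ 4^-1)%:E <=
    radius_of_convexity (bessel_cross nu))%E.
Proof.
move=> hnu Tb d3; have /andP[T0 T1] := Tb; have x0 : 0 < nu + 1 by lra.
set a := 16 * pochhammer (nu + 1) 3; have a0 : 0 < a by rewrite mulr_gt0// pochhammer_gt0.
set rho := _ `^ _.
apply: ereal_sup_ubound; exists rho => //; split.
  by rewrite powR_gt0// mulr_gt0.
move=> z; rewrite norm_cabs ltcR => zr.
pose t : R[i]^o := (a^-1)%:C%C * z ^+ 4.
have tT : cabs t <= T.
  rewrite cabsM cabs_real cabsX gtr0_norm ?invr_gt0// ler_pdivrMl//.
  rewrite -[leRHS](@powR_rootK _ _ 4)//; last by rewrite mulr_ge0// ltW.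
  by rewrite lerXn2r// ?nnegrE ?powR_ge0 ?cabs_ge0// ltW.
have [G0 D0] := convex_disk x0 Tb d3 tT.
have e1 := @bessel_cross_deriv1 R nu z hnu.
have e2 := @bessel_cross_deriv2 R nu z hnu.
rewrite -/t in e1 e2; rewrite -e1 -e2 in G0 D0; split=> //.
by rewrite mulrDl divff in D0.
Qed.

Lemma pochhammer5 (R : realType) (x : R) :
  pochhammer x 5 = pochhammer x 3 * (x + 3) * (x + 4).
Proof. by rewrite 2!pochhammerS. Qed.

Unset Implicit Arguments.

Theorem theorem14 (R : realType) (nu : R) (hnu : -1 < nu) :
  let rc := radius_of_convexity (bessel_cross nu) in
  (rc < ((4 * pochhammer (nu + 1) 3 / 5) `^ (4^-1))%:E)%E /\
  ((2 * (pochhammer (nu + 1) 3 / 25) `^ (4^-1))%:E < rc)%E /\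
  (rc < (2 * (25 * pochhammer (nu + 1) 5 / nu13 nu) `^ (4^-1))%:E)%E /\
  ((2 * (pochhammer (nu + 1) 3 * pochhammer (nu + 1) 5 / nu13 nu)
      `^ (8^-1))%:E < rc)%E /\
  (rc < ((8 * pochhammer (nu + 1) 3 * (nu + 6) * (nu + 7) * nu13 nu
          / (3 * nu14 nu)) `^ (4^-1))%:E)%E.
Proof.
move=> rc.
have x0 : 0 < nu + 1 by lra.
have p2 := exprn_gt0 2 x0; have p3 := exprn_gt0 3 x0; have p4 := exprn_gt0 4 x0.
have m0 : 0 < nu13 nu by rewrite /nu13; lra.
have M0 : 0 < nu14 nu by rewrite /nu14; lra.
have P0 : 0 < pochhammer (nu + 1) 3 by exact: pochhammer_gt0.
rewrite pochhammer5.
have -> : nu + 1 + 3 = nu + 4 by ring.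
have -> : nu + 1 + 4 = nu + 5 by ring.
set P := pochhammer _ _ in P0 *.
(* The values of [T] that correspond to the last upper and the last lower bound. *)
pose X := (nu + 6) * (nu + 7) * nu13 nu / (6 * nu14 nu).
pose Y := Num.sqrt ((nu + 4) * (nu + 5) / nu13 nu).
have q0 : 0 < (nu + 4) * (nu + 5) / nu13 nu by rewrite divr_gt0// mulr_gt0//; lra.
have Y0 : 0 < Y by rewrite sqrtr_gt0.
have Y2 : Y ^+ 2 = (nu + 4) * (nu + 5) / nu13 nu by rewrite sqr_sqrtr// ltW.
have X0 : 0 < X by rewrite divr_gt0// mulr_gt0//; [rewrite mulr_gt0//; lra|lra..].
(* These comparisons reduce the first three bounds to the last two. *)
have X20 : X < 20^-1.
  by rewrite ltr_pdivrMr ?mulr_gt0// /nu13 /nu14; have := exprn_gt0 5 x0; lra.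
have X3 : X < 25 * ((nu + 4) * (nu + 5)) / nu13 nu.
  rewrite ltr_pdivlMr// mulrAC ltr_pdivrMr ?mulr_gt0// /nu13 /nu14.
  have := exprn_gt0 5 x0; have := exprn_gt0 6 x0; lra.
have Y20 : Y < 20^-1.
  rewrite -(ltr_pXn2r (n := 2))// ?nnegrE ?ltW ?invr_gt0// Y2 ltr_pdivrMr// /nu13.
  lra.
have Y25 : 25^-1 < Y.
  rewrite -(ltr_pXn2r (n := 2))// ?nnegrE ?ltW ?invr_gt0// Y2 ltr_pdivlMr// /nu13.
  lra.
have up Z : X <= Z -> (rc < ((16 * P * Z) `^ 4^-1)%:E)%E.
  move=> XZ.
  have d4E T : dsum3 (nu + 1) T + 289 * ncoef (nu + 1) 4 * T ^+ 4 =
    (Poly [:: 1; -25; 81 * ncoef (nu + 1) 2; - 169 * ncoef (nu + 1) 3; 289 * ncoef (nu + 1) 4]).[T].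
    by rewrite horner_Poly /= /dsum3; ring.
  have [||T /andP[T0 TX]] := @horner_lt0_left R
    (Poly [:: 1; -25; 81 * ncoef (nu + 1) 2; - 169 * ncoef (nu + 1) 3; 289 * ncoef (nu + 1) 4]) X => //.
    by rewrite -d4E; exact: dsum4_lt0.
  rewrite -d4E => d4.
  apply: (@le_lt_trans _ _ ((16 * P * T) `^ 4^-1)%:E).
    apply: radius_of_convexity_le => //; last exact: ltW.
    by rewrite T0 /=; lra.
  rewrite lte_fin; apply: ltr_root4; first by rewrite !mulr_ge0// ltW.
  by rewrite ltr_pM2l ?mulr_gt0//; lra.
have low Z : 0 <= Z <= Y -> (((16 * P * Z) `^ 4^-1)%:E < rc)%E.
  move=> /andP[Z0 ZY].
  have d3E T : dsum3 (nu + 1) T =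
    (Poly [:: 1; -25; 81 * ncoef (nu + 1) 2; - 169 * ncoef (nu + 1) 3]).[T].
    by rewrite horner_Poly /= /dsum3; ring.
  have [||T /andP[T0 TX]] := @horner_gt0_right R
    (Poly [:: 1; -25; 81 * ncoef (nu + 1) 2; - 169 * ncoef (nu + 1) 3]) Y 20^-1 => //.
    by rewrite -d3E; exact: dsum3_gt0.
  rewrite -d3E => d3.
  apply: (@lt_le_trans _ _ ((16 * P * T) `^ 4^-1)%:E).
    rewrite lte_fin; apply: ltr_root4; first by rewrite !mulr_ge0// ltW.
    by rewrite ltr_pM2l ?mulr_gt0//; lra.
  by apply: radius_of_convexity_ge => //; apply/andP; split; lra.
split; first by rewrite (_ : 4 * P / 5 = 16 * P * 20^-1); [apply: up; exact: ltW|field].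
split.
  rewrite mulr2_root4; last by rewrite divr_ge0// ltW.
  by rewrite mulrA; apply: low; rewrite invr_ge0 ltW// ltW.
split.
  rewrite mulr2_root4; last by rewrite divr_ge0// ?ltW// !mulr_gt0//; lra.
  rewrite (_ : 16 * _ = 16 * P * (25 * ((nu + 4) * (nu + 5)) / nu13 nu)); last by field; lra.
  by apply: up; exact: ltW.
split.
  have := low Y; rewrite lexx (ltW Y0) => /(_ isT).
  congr (_%:E < _)%E; apply: (@pexpIrn R 8) => //; rewrite ?nnegrE ?mulr_ge0 ?powR_ge0//.
  rewrite (exprM _ 4 2) powR_rootK//; last by rewrite !mulr_ge0// ltW.
  rewrite [RHS]exprMn powR_rootK//; last first.
    by rewrite divr_ge0// ?ltW// !mulr_gt0//; lra.
  by rewrite exprMn Y2; field; lra.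
rewrite (_ : _ / (3 * nu14 nu) = 16 * P * X); first exact: up.
by rewrite /X; field; lra.
Qed.
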